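(* Let $d\geq 3$ be fixed. There exist constants $k_d,n_0$ depending only on $d$, a family of distinguishing functions $\{F_G: G \text{ a } d\text{-regular graph on } [n]\}$ with values in $\{0,1\}$, and a fixed query sequence $Q$ of $n^{1/4}$ queries such that any (possibly randomized) algorithm $\mathcal{A}$ that is given $\textsc{rand\_neighbor}$ and $\textsc{rand\_vertex}$ probe access to $G\leftarrow\mathbf{G}(n,d)$ and makes fewer than $n^{1/4}/k_d$ probes per query satisfies, for all $n\geq n_0$, $$\mathbb{E}_{G\leftarrow\mathbf{G}(n,d)}\left|F_G(P_Q(\mathcal{U}))-F_G(D_{G,\mathcal{A},Q})\right|\geq 0.99,$$ where $D_{G,\mathcal{A},Q}$ is the distribution of $\mathcal{A}$'s responses given probe access to $G$ over the sequence $Q$.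
   Context: $\mathbf{G}(n,d)$ is the uniform distribution over $d$-regular graphs on vertex set $[n]$ (for $d$ odd, $n$ is restricted to be even). Probe access: $\textsc{rand\_neighbor}(v)$ returns a uniformly random neighbor of $v$ and $\textsc{rand\_vertex}$ returns a uniformly random vertex. $\mathcal{U}$ is the distribution of random walks on $G$ from vertex $1$; for a set of times $Q$, $P_Q(\mathcal{U})$ is the joint distribution of the positions at the times in $Q$. The algorithm $\mathcal{A}$ receives the time queries of $Q$ one at a time (the sequence being fixed in advance, independent of the algorithm's answers and state) and answers each with a vertex. For a distribution $D$ over tuples of answers, $F_G(D)$ denotes $\mathbb{E}_{x\sim D}F_G(x)$. *)

(* Defs.v *)
From HB Require Import structures.
From mathcomp Require Import all_boot all_order all_algebra.
From mathcomp Require Import all_classical all_reals all_analysis.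

Set Implicit Arguments.
Unset Strict Implicit.
Unset Printing Implicit Defensive.

Import Order.TTheory GRing.Theory Num.Theory.

Local Open Scope ring_scope.

(* A simple graph on 'I_n is encoded by its neighbourhood map; this encoding is
   one-to-one, so counting maps is counting labelled graphs. *)
Definition is_regular_graph (n d : nat) (N : {ffun 'I_n -> {set 'I_n}}) : bool :=
  [&& [forall u, forall v, (v \in N u) == (u \in N v)],
      [forall v, v \notin N v] &
      [forall v, #|N v| == d]].

Definition regular_graph (n d : nat) : Type :=
  {N : {ffun 'I_n -> {set 'I_n}} | is_regular_graph d N}.

Definition nbrs (n d : nat) (G : regular_graph n d) (v : 'I_n) : {set 'I_n} :=
  sval G v.

Definition expect_graph (R : realType) (n d : nat) (f : regular_graph n d -> R) : R :=
  (\sum_(G : {: regular_graph n d}) f G) / #|{: regular_graph n d}|%:R.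

(* Distributions over answer tuples are given by their mass functions. *)
Definition expect_bool (R : realType) (n m : nat)
    (F : m.-tuple 'I_n -> bool) (D : m.-tuple 'I_n -> R) : R :=
  \sum_(x : m.-tuple 'I_n) D x * (F x)%:R.

Definition walk_step (R : realType) (n d : nat) (G : regular_graph n d)
    (u v : 'I_n) : R :=
  (v \in nbrs G u)%:R / #|nbrs G u|%:R.

(* Law of the first T steps of the simple random walk; vertex 1 of [n] is the
   ordinal with value 0. *)
Definition walk_prob (R : realType) (n d : nat) (G : regular_graph n d)
    (T : nat) (w : {ffun 'I_T.+1 -> 'I_n}) : R :=
  (val (w ord0) == 0%N)%:R *
  \prod_(t < T) walk_step R G (w (inord t)) (w (inord t.+1)).

Definition horizon (m : nat) (Q : m.-tuple nat) : nat :=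
  \max_(i < m) tnth Q i.

Definition walk_law (R : realType) (n d : nat) (G : regular_graph n d)
    (m : nat) (Q : m.-tuple nat) (x : m.-tuple 'I_n) : R :=
  \sum_(w : {ffun 'I_(horizon Q).+1 -> 'I_n}
        | [forall i : 'I_m, w (inord (tnth Q i)) == tnth x i])
    walk_prob R G w.

(* A terminating computation with adaptive probes and a result in X; the
   continuations receive the probe's reply. *)
Inductive probing (n : nat) (X : Type) : Type :=
| Done of X
| RandNeighbor of 'I_n & ('I_n -> probing n X)
| RandVertex of ('I_n -> probing n X).

Arguments Done {n X} _.
Arguments RandNeighbor {n X} _ _.
Arguments RandVertex {n X} _.

Fixpoint probing_bind (n : nat) (X Y : Type) (p : probing n X)
    (f : X -> probing n Y) : probing n Y :=
  match p with
  | Done x => f x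
  | RandNeighbor v k => RandNeighbor v (fun u => probing_bind (k u) f)
  | RandVertex k => RandVertex (fun u => probing_bind (k u) f)
  end.

(* Probability, over the probe replies, that the result satisfies e. *)
Fixpoint probing_prob (R : realType) (n d : nat) (G : regular_graph n d)
    (X : Type) (p : probing n X) (e : pred X) : R :=
  match p with
  | Done x => (e x)%:R
  | RandNeighbor v k =>
      (\sum_(u in nbrs G v) probing_prob R G (k u) e) / #|nbrs G v|%:R
  | RandVertex k => (\sum_(u < n) probing_prob R G (k u) e) / n%:R
  end.

(* Largest number of probes on G, over all possible replies. *)
Fixpoint max_probes (n d : nat) (G : regular_graph n d) (X : Type)
    (p : probing n X) : nat :=
  match p with
  | Done _ => 0
  | RandNeighbor v k => (\max_(u in nbrs G v) max_probes G (k u)).+1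
  | RandVertex k => (\max_(u < n) max_probes G (k u)).+1
  end.

Fixpoint possible_result (n d : nat) (G : regular_graph n d) (X : Type)
    (p : probing n X) (x : X) : Prop :=
  match p with
  | Done y => x = y
  | RandNeighbor v k => exists2 u, u \in nbrs G v & possible_result G (k u) x
  | RandVertex k => exists u, possible_result G (k u) x
  end.

(* h s t answers the time query t from memory s, returning the updated memory
   and the answer. *)
Fixpoint respond (n : nat) (S : Type) (h : S -> nat -> probing n (S * 'I_n))
    (s : S) (Q : seq nat) : probing n (seq 'I_n) :=
  match Q with
  | [::] => Done [::]
  | t :: Q' =>
      probing_bind (h s t) (fun r =>
        probing_bind (respond h r.1 Q') (fun xs => Done (r.2 :: xs)))
  end.

Fixpoint respects_budget (R : realType) (n d : nat) (G : regular_graph n d)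
    (S : Type) (h : S -> nat -> probing n (S * 'I_n)) (b : R)
    (s : S) (Q : seq nat) : Prop :=
  match Q with
  | [::] => True
  | t :: Q' =>
      (max_probes G (h s t))%:R < b /\
      forall r, possible_result G (h s t) r -> respects_budget G h b r.1 Q'
  end.

(* All internal randomness is a seed drawn from an arbitrary probability space;
   alg_measurable is what makes the law of the responses meaningful. *)
Record algorithm (R : realType) (n d : nat) : Type := Algorithm {
  alg_display : measure_display;
  alg_seed : measurableType alg_display;
  alg_law : probability alg_seed R;
  alg_memory : Type;
  alg_init : alg_memory;
  alg_query : alg_seed -> alg_memory -> nat -> probing n (alg_memory * 'I_n);
  alg_measurable :
    forall (G : regular_graph n d) (Q : seq nat) (x : seq 'I_n),
      measurable_fun setT (fun w : alg_seed =>
        probing_prob R G (respond (alg_query w) alg_init Q) (pred1 x))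
}.

Definition response_law (R : realType) (n d : nat) (G : regular_graph n d)
    (A : algorithm R n d) (m : nat) (Q : m.-tuple nat) (x : m.-tuple 'I_n) : R :=
  Rintegral (alg_law A) setT (fun w =>
    probing_prob R G (respond (alg_query w) (alg_init A) Q) (pred1 (tval x))).

Definition probes_per_query_lt (R : realType) (n d : nat)
    (A : algorithm R n d) (Q : seq nat) (b : R) : Prop :=
  forall (G : regular_graph n d) (w : alg_seed A),
    respects_budget G (alg_query w) b (alg_init A) Q.

Definition num_queries (R : realType) (n : nat) : nat :=
  Num.truncn (n%:R `^ 4^-1 : R).

(* Main.v *)
Require Import Defs.
From HB Require Import structures.
From mathcomp Require Import all_boot all_order all_algebra.
From mathcomp Require Import all_classical all_reals all_analysis.
From mathcomp Require Import zify ring lra.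

Set Implicit Arguments.
Unset Strict Implicit.
Unset Printing Implicit Defensive.

Import Order.TTheory GRing.Theory Num.Theory.

Local Open Scope ring_scope.

(** The times 1, ..., m with m = n^(1/4) are queried, the last one first.  An answer
    is accepted when it is a walk in G from the first vertex whose length after
    cancelling backtracks exceeds n^(1/4)/100.

    On every d-regular graph the reduced length of the random walk is a biased walk
    on the naturals (exactly one of the d neighbours cancels the last step), so it
    grows linearly except with exponentially small probability.

    The algorithm makes fewer than sqrt(n)/100 probes.  Given the replies so far, G is
    uniform among the regular graphs containing the set H of edges seen, and an edge
    switching shows that such a G contains a prescribed further edge with probability
    at most 2d/n.  Hence, up to a small error, every new edge leads to a new vertex:
    H stays a forest in which the ancestors of a vertex never change once it is known.
    A walk in H from the root has as reduced length the depth of its endpoint; the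
    endpoint is the first answer, and its depth is at most the number of probes made
    for that query. *)

(** * Regular graphs *)

Lemma nbrs_sym n d (G : regular_graph n d) u v :
  (v \in nbrs G u) = (u \in nbrs G v).
Proof.
by case: G => N hN; rewrite /nbrs /=; case/and3P: hN => /forallP/(_ u)/forallP/(_ v)/eqP.
Qed.

Lemma nbrs_irr n d (G : regular_graph n d) v : (v \in nbrs G v) = false.
Proof.
by apply/negbTE; case: G => N hN; rewrite /nbrs /=; case/and3P: hN => _ /forallP/(_ v).
Qed.

Lemma card_nbrs n d (G : regular_graph n d) v : #|nbrs G v| = d.
Proof.
by case: G => N hN; rewrite /nbrs /=; case/and3P: hN => _ _ /forallP/(_ v)/eqP.
Qed.

(** This is the Cayley graph of the cyclic group with connection set [S]: closure under negation
    makes adjacency symmetric, and injectivity of translations gives the degree. *)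
Lemma cayley_regular n d (S : {set 'I_n.+1}) :
  #|S| = d -> 0 \notin S -> (forall s, s \in S -> - s \in S) ->
  is_regular_graph d [ffun u => [set u + s | s in S]].
Proof.
move=> cS S0 SN.
have memS u v : (v \in [set u + s | s in S]) = (v - u \in S).
  apply/imsetP/idP => [[s sS ->]|h]; first by rewrite addrAC subrr add0r.
  by exists (v - u) => //; rewrite addrCA subrr addr0.
apply/and3P; split.
- apply/forallP => u; apply/forallP => v; rewrite !ffunE !memS; apply/eqP.
  by apply/idP/idP => /SN; rewrite opprB.
- by apply/forallP => v; rewrite ffunE memS subrr.
- by apply/forallP => v; rewrite ffunE card_imset ?cS //; exact: addrI.
Qed.

Lemma symmetric_shifts n d : (d < n.+1)%N -> (odd d -> ~~ odd n.+1) ->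
  exists S : {set 'I_n.+1},
    [/\ #|S| = d, 0 \notin S & forall s, s \in S -> - s \in S].
Proof.
move=> dn odn.
(* [A] holds the shifts 1, ..., [e], [B] their negatives, and for odd [d] the set [C] holds the
   element of order two. They lie below, above and at half the modulus, hence are disjoint. *)
pose e := d./2; have de := odd_double_half d.
pose A := [set (inord i.+1 : 'I_n.+1) | i : 'I_e].
pose B := [set - x | x in A].
pose C : {set 'I_n.+1} := if odd d then [set inord n.+1./2] else finset.set0.
have ie (i : 'I_e) : (i.+1.*2 <= d)%N by have := ltn_ord i; rewrite /e; lia.
have vA x : x \in A -> (0 < x)%N && (x.*2 < n.+1)%N.
  by case/imsetP => i _ ->; have ? := ie i; rewrite inordK; lia.
have vN (x : 'I_n.+1) : (0 < x)%N -> nat_of_ord (- x) = (n.+1 - x)%N.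
  by move=> x0; rewrite /= modn_small //; have := ltn_ord x; lia.
have vB x : x \in B -> (0 < x)%N && (n.+1 < x.*2)%N.
  by case/imsetP => y /vA/andP[y0 yn] ->; rewrite vN //; lia.
have vC x : x \in C -> (0 < x)%N && (x.*2 == n.+1).
  rewrite /C; case: ifP => [od|_]; last by rewrite inE.
  by move/set1P => ->; have ? := odn od; have ? := odd_double_half n.+1; rewrite inordK; lia.
have cA : #|A| = e.
  rewrite card_imset ?card_ord // => i j /(congr1 val) /=.
  by have := ie i; have := ie j => ? ?; rewrite !inordK; [|lia|lia] => -[] /val_inj.
have cB : #|B| = e by rewrite card_imset //; exact: oppr_inj.
have cC : #|C| = odd d by rewrite /C; case: ifP; rewrite ?cards1 ?cards0.
exists (A :|: B :|: C); split.
- rewrite cardsU cardsU cA cB cC.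
  have -> : A :&: B = finset.set0.
    by apply/setP => x; rewrite !inE; apply/negP => /andP[/vA ? /vB]; lia.
  have -> : (A :|: B) :&: C = finset.set0.
    by apply/setP => x; rewrite !inE; apply/negP => /andP[/orP[/vA|/vB] ? /vC]; lia.
  by rewrite cards0; lia.
- by rewrite !inE; apply/negP => /orP[/orP[/vA|/vB]|/vC].
- move=> s; rewrite !inE => /orP[/orP[sA|/imsetP[x xA ->]]|sC].
  + by rewrite (imset_f _ sA) orbT.
  + by rewrite opprK xA.
  + apply/orP; right; suff -> : - s = s by [].
    by apply: val_inj; have /andP[s0 sn] := vC _ sC; have := vN _ s0; move=> /= ->; lia.
Qed.

Lemma regular_graph_exists n d : (d < n)%N -> (odd d -> ~~ odd n) ->
  (0 < #|{: regular_graph n d}|)%N.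
Proof.
case: n => [//|n] dn /(symmetric_shifts dn)[S [cS S0 SN]].
by apply/card_gt0P; exists (exist (fun N => is_regular_graph d N) _ (cayley_regular cS S0 SN)).
Qed.

(** * Edge switching *)

Definition contains n d (H : seq ('I_n * 'I_n)) (G : regular_graph n d) : bool :=
  all (fun e => e.2 \in nbrs G e.1) H.

Definition num_ext n d (H : seq ('I_n * 'I_n)) : nat :=
  #|[pred G : regular_graph n d | contains H G]|.

Section Switching.
Variables (n d : nat) (u v x y : 'I_n).

(* The edges uv, xy are exchanged for ux, vy. *)
Definition switched (a b : 'I_n) : bool :=
  (a, b) \in [:: (u, v); (v, u); (x, y); (y, x); (u, x); (x, u); (v, y); (y, v)].

(** Written as a symmetric difference, the exchange is an involution, from which injectivity of
    switching follows. *)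
Definition toggle (N : {ffun 'I_n -> {set 'I_n}}) : {ffun 'I_n -> {set 'I_n}} :=
  [ffun a => [set b | (b \in N a) (+) switched a b]].

Lemma toggleK : involutive toggle.
Proof.
move=> N; apply/ffunP => a; apply/setP => b.
by rewrite !ffunE !inE -addbA addbb addbF.
Qed.

(** The default value [G] is taken when the toggled map is not regular; this does not happen for
    switchable [G]. *)
Definition switch (G : regular_graph n d) : regular_graph n d :=
  insubd (G : {N | is_regular_graph d N}) (toggle (val G)).

Lemma card_toggle_row (A : {set 'I_n}) p q : p \in A -> q \notin A ->
  #|[set b | (b \in A) (+) ((b == p) || (b == q))]| = #|A|.
Proof.
move=> pA qA.
have -> : [set b | (b \in A) (+) ((b == p) || (b == q))] = q |: (A :\ p).
  apply/setP => b; rewrite !inE.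
  have [->|bp] := eqVneq b p.
    by rewrite pA; have [e|] := eqVneq p q => //; rewrite -e pA in qA.
  by have [->|bq] := eqVneq b q; rewrite ?(negbTE qA) ?addbF.
by rewrite cardsU1 !inE (negbTE qA) andbF (cardsD1 p A) pA.
Qed.

(** The last two conditions keep the new edges ux and vy from being loops or double edges; together
    with the first two they also make the four vertices distinct. *)
Definition switchable (G : regular_graph n d) : bool :=
  [&& v \in nbrs G u, y \in nbrs G x, x \notin u |: nbrs G u & y \notin v |: nbrs G v].

Lemma toggle_regular G : switchable G -> is_regular_graph d (toggle (val G)).
Proof.
case/and4P => uv xy; rewrite !inE !negb_or => /andP[xu ux] /andP[yv vy].
have sym := @nbrs_sym _ _ G; have irr := @nbrs_irr _ _ G.
have uNv : u != v by apply: contraTneq uv => ->; rewrite irr.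
have xNy : x != y by apply: contraTneq xy => ->; rewrite irr.
have xNv : x != v by apply: contraNneq ux => ->.
have yNu : y != u by apply: contraNneq vy => ->; rewrite sym.
have dst := (negbTE uNv, negbTE xNy, negbTE xNv, negbTE yNu, negbTE xu, negbTE yv,
  eq_sym v u, eq_sym y x, eq_sym v x, eq_sym u y, eq_sym u x, eq_sym v y).
apply/and3P; split.
- apply/forallP => a; apply/forallP => b; rewrite !ffunE !inE.
  have := sym a b; rewrite /nbrs => ->; apply/eqP; congr (_ (+) _).
  by rewrite /switched !inE !xpair_eqE; do 8!case: (_ == _).
- apply/forallP => a; rewrite !ffunE !inE; have := irr a; rewrite /nbrs => ->.
  rewrite /switched !inE !xpair_eqE /=.
  have [->|] := eqVneq a u; first by rewrite !dst.
  have [->|] := eqVneq a v; first by rewrite !dst.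
  have [->|] := eqVneq a x; first by rewrite !dst.
  by have [->|] := eqVneq a y; first by rewrite !dst.
- apply/forallP => a; rewrite ffunE.
  have cN := card_nbrs G a; rewrite /nbrs in cN.
  suff -> : #|[set b | (b \in sval G a) (+) switched a b]| = #|sval G a| by rewrite cN.
  (* Each of the rows of u, v, x, y loses one neighbour and gains one; all other rows stay
     unchanged. *)
  have row p q : p \in nbrs G a -> q \notin nbrs G a ->
      (forall b, switched a b = (b == p) || (b == q)) ->
      #|[set b | (b \in sval G a) (+) switched a b]| = #|sval G a|.
    move=> pa qa e; rewrite -(card_toggle_row pa qa); apply: eq_card => b.
    by rewrite !inE e.
  have [au|au] := eqVneq a u.
    apply: (row v x); rewrite ?au // => b.
    by rewrite /switched !inE !xpair_eqE !dst !eqxx /= ?orbF.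
  have [av|av] := eqVneq a v.
    apply: (row u y); rewrite ?av // ?(sym v) // => b.
    by rewrite /switched !inE !xpair_eqE !dst !eqxx /= ?orbF.
  have [ax|ax] := eqVneq a x.
    apply: (row y u); rewrite ?ax // 1?sym // => b.
    by rewrite /switched !inE !xpair_eqE !dst !eqxx /= ?orbF.
  have [ay|ay] := eqVneq a y.
    apply: (row x v); rewrite ?ay // 1?sym // => b.
    by rewrite /switched !inE !xpair_eqE !dst !eqxx /= ?orbF.
  apply: eq_card => b; rewrite !inE /switched !inE !xpair_eqE.
  by rewrite (negbTE au) (negbTE av) (negbTE ax) (negbTE ay) addbF.
Qed.

Lemma switchE G a b : switchable G ->
  (b \in nbrs (switch G) a) = (b \in nbrs G a) (+) switched a b.
Proof.
move=> sG; rewrite /nbrs /switch -/(val _) val_insubd toggle_regular //.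
by rewrite ffunE inE.
Qed.

Lemma switch_inj : {in switchable &, injective switch}.
Proof.
move=> G1 G2 s1 s2 /(congr1 val); rewrite /switch !val_insubd !toggle_regular //.
by move=> /(can_inj toggleK)/val_inj.
Qed.

End Switching.

Section CountArcs.
Variables (n d : nat) (G : regular_graph n d).

Definition arcs : {set 'I_n * 'I_n} := [set p | p.2 \in nbrs G p.1].

Lemma card_arcs_from (A : {set 'I_n}) :
  #|[set p in arcs | p.1 \in A]| = (#|A| * d)%N.
Proof.
rewrite -sum1_card (eq_bigl (fun p => (p.1 \in A) && (p.2 \in nbrs G p.1))); last first.
  by move=> p; rewrite !inE andbC.
rewrite -(pair_big_dep (mem A) (fun a b => b \in nbrs G a) (fun _ _ => 1%N)) /=.
rewrite -sum_nat_const; apply: eq_bigr => a _.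
by rewrite sum1_card card_nbrs.
Qed.

Lemma card_arcs_to (A : {set 'I_n}) :
  #|[set p in arcs | p.2 \in A]| = (#|A| * d)%N.
Proof.
rewrite -card_arcs_from -(card_imset _ (can_inj swap_pairK)); apply: eq_card => -[a b].
apply/imsetP/idP => [[[x y]]|]; rewrite !inE /= => /andP[xy h].
  by case=> -> ->; rewrite -nbrs_sym xy.
by exists (b, a); rewrite // !inE /= nbrs_sym xy.
Qed.

Lemma card_arcs : #|arcs| = (n * d)%N.
Proof.
rewrite -[n in RHS]card_ord -cardsT -card_arcs_from; apply: eq_card => p.
by rewrite !inE andbT.
Qed.

End CountArcs.

(** Among the nd arcs, at most 2|H| lie in [H] in one of the two directions, and d(d+1) each start
    in the closed neighbourhood of [u] or end in that of [v]. *)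
Lemma card_arcs_switchable n d (G : regular_graph n d) (H : seq ('I_n * 'I_n)) u v :
  v \in nbrs G u ->
  (n * d <= #|[set p : 'I_n * 'I_n |
                [&& switchable u v p.1 p.2 G, p \notin H & swap_pair p \notin H]]|
     + (2 * size H + 2 * (d.+1 * d)))%N.
Proof.
move=> uv; rewrite -(card_arcs G); set good := [set p | _].
pose B1 : {set 'I_n * 'I_n} := [set p | p \in H].
pose B2 : {set 'I_n * 'I_n} := [set p | swap_pair p \in H].
pose B3 := [set p in arcs G | p.1 \in u |: nbrs G u].
pose B4 := [set p in arcs G | p.2 \in v |: nbrs G v].
have cU w : #|w |: nbrs G w| = d.+1 by rewrite cardsU1 nbrs_irr card_nbrs.
have c1 : (#|B1| <= size H)%N.
  rewrite (leq_trans _ (card_size H)) // subset_leq_card //.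
  by apply/fintype.subsetP => p; rewrite inE.
have c2 : (#|B2| <= size H)%N.
  rewrite (leq_trans _ c1) // -(card_imset _ (can_inj swap_pairK)) subset_leq_card //.
  by apply/fintype.subsetP => _ /imsetP[p + ->]; rewrite !inE.
have c3 : #|B3| = (d.+1 * d)%N by rewrite card_arcs_from cU.
have c4 : #|B4| = (d.+1 * d)%N by rewrite card_arcs_to cU.
have sub : arcs G \subset good :|: (B1 :|: B2 :|: (B3 :|: B4)).
  apply/fintype.subsetP => p pA; rewrite 2!finset.in_setU.
  case: (boolP (p \in B1 :|: B2)) => [|h].
    by rewrite orbT.
  case: (boolP (p \in B3 :|: B4)) => [|h']; first by rewrite !orbT.
  move: pA h h'; rewrite !inE !negb_or => pA; rewrite pA /switchable uv pA !inE !negb_or /=.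
  by move=> /andP[-> ->] /andP[-> ->].
have := leq_trans (subset_leq_card sub) (leq_card_setU _ _).1.
have := (leq_card_setU (B1 :|: B2) (B3 :|: B4)).1.
have := (leq_card_setU B1 B2).1; have := (leq_card_setU B3 B4).1.
move: c1 c2 c3 c4; move: #|B1| #|B2| #|B3| #|B4| #|good|; lia.
Qed.

(** Double counting of pairs of a graph and an arc. By the size bound, at least half of the nd arcs
    can be switched with uv without touching [H]. Switching maps these pairs injectively to graphs
    containing [H] with a chosen neighbour of [u] and of [v], and there are d^2 such choices per
    graph. *)
Lemma num_ext_edge n d (H : seq ('I_n * 'I_n)) u v :
  (0 < d)%N -> (u, v) \notin H -> (v, u) \notin H ->
  (4 * size H + 4 * (d.+1 * d) <= n * d)%N ->
  (n * num_ext d ((u, v) :: H) <= 2 * d * num_ext d H)%N.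
Proof.
move=> d0 uvH vuH big.
pose P (G : regular_graph n d) (p : 'I_n * 'I_n) :=
  [&& contains ((u, v) :: H) G, switchable u v p.1 p.2 G, p \notin H & swap_pair p \notin H].
pose A := [set z : regular_graph n d * ('I_n * 'I_n) | P z.1 z.2].
pose B := [set z : regular_graph n d * ('I_n * 'I_n) |
  [&& contains H z.1, z.2.1 \in nbrs z.1 u & z.2.2 \in nbrs z.1 v]].
(* Keeping the arc beside the switched graph makes the switching reversible. *)
pose f (z : regular_graph n d * ('I_n * 'I_n)) := (switch u v z.2.1 z.2.2 z.1, z.2).
have cA : (n * d * num_ext d ((u, v) :: H) <= 2 * #|A|)%N.
  rewrite -sum1_card (eq_bigl (fun z => contains ((u, v) :: H) z.1 && P z.1 z.2)); last first.
    by move=> z; rewrite inE /P; case: (contains _ _).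
  rewrite -(pair_big_dep (contains ((u, v) :: H)) P (fun _ _ => 1%N)) /=.
  rewrite mulnC -sum_nat_const big_distrr /=; apply: leq_sum => G GH'.
  have GH : contains ((u, v) :: H) G := GH'.
  have /card_arcs_switchable-/(_ H) : v \in nbrs G u by case/andP: GH.
  rewrite sum1_card; have -> : #|P G| = #|[set p : 'I_n * 'I_n |
      [&& switchable u v p.1 p.2 G, p \notin H & swap_pair p \notin H]]|.
    by apply: eq_card => p; rewrite inE -topredE /= /P GH.
  lia.
have cB : #|B| = (d * d * num_ext d H)%N.
  rewrite -sum1_card (eq_bigl (fun z => contains H z.1 &&
      (z.2 \in finset.setX (nbrs z.1 u) (nbrs z.1 v)))); last first.
    by move=> z; rewrite !inE.
  rewrite -(pair_big_dep (contains H)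
    (fun G z => z \in finset.setX (nbrs G u) (nbrs G v)) (fun _ _ => 1%N)) /=.
  rewrite mulnC -sum_nat_const; apply: eq_bigr => G _.
  by rewrite sum1_card cardsX !card_nbrs.
have fA : {in A &, injective f}.
  move=> [G1 p1] [G2 p2]; rewrite !inE /= => /and4P[_ s1 _ _] /and4P[_ s2 _ _].
  by case=> eG ep; rewrite -ep in s2 eG *; rewrite (switch_inj s1 s2 eG).
have fB : f @: A \subset B.
  apply/fintype.subsetP => _ /imsetP[[G [x y]] + ->]; rewrite inE /P /=.
  case/and4P => /andP[/= uv HG] sG xyH yxH; rewrite inE /= !switchE //.
  have /and4P[_ xy] := sG; rewrite !inE !negb_or => /andP[xu ux] /andP[yv vy].
  rewrite (negbTE ux) (negbTE vy) /switched !inE !eqxx ?orbT ?andbT /=.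
  apply/allP => -[a b] abH /=; rewrite switchE //.
  have ab : b \in nbrs G a := allP HG _ abH.
  rewrite ab /= /switched !inE !negb_or.
  (* The edges of [H] survive: the removed edges are outside [H], and the added ones are not edges
     of [G]. *)
  have ne p q : (p, q) \notin H -> (a, b) != (p, q) by apply: contraNneq => <-.
  have ne' p q : q \notin nbrs G p -> (a, b) != (p, q).
    by apply: contraNneq => -[<- <-].
  rewrite (ne u v) // (ne v u) // (ne x y) // (ne y x) //.
  by rewrite (ne' u x) // (ne' v y) // (ne' x u) 1?nbrs_sym // (ne' y v) 1?nbrs_sym.
have := subset_leq_card fB; rewrite (card_in_imset fA) cB => AB.
have := leq_trans cA (leq_mul (leqnn 2) AB) => le; rewrite -(leq_pmul2l d0); lia.
Qed.

(** * Reduced walks and explored forests *)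

Section Reduction.
Variable T : eqType.

(** The state is the current vertex with a stack of the earlier vertices of the reduced walk, latest
    first; stepping back to the top of the stack pops it. *)
Definition reduce_step (st : T * seq T) (y : T) : T * seq T :=
  if ohead st.2 == Some y then (y, behead st.2) else (y, st.1 :: st.2).

Definition reduce (x : T) (s : seq T) : T * seq T := foldl reduce_step (x, [::]) s.

End Reduction.

Section Exploration.
Variables (n : nat) (v0 : 'I_n).
Implicit Types (H : seq ('I_n * 'I_n)) (V : {set 'I_n}) (anc : 'I_n -> seq 'I_n).

Definition explored H : rel 'I_n := fun x y => ((x, y) \in H) || ((y, x) \in H).

(* H is the set of edges seen so far and V a set of vertices containing all their
   endpoints; anc x lists the ancestors of x, parent first, in the forest H. *)
Record exploration H V anc : Prop := Exploration {
  root_known : v0 \in V;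
  root_anc : anc v0 = [::];
  edge_anc : forall x y, (x, y) \in H ->
    [/\ x \in V, y \in V & anc y = x :: anc x \/ anc x = y :: anc y];
  cons_anc : forall x y s, anc x = y :: s -> [/\ x \in V, y \in V & anc y = s] }.

Lemma exploration0 : exploration [::] [set v0] (fun=> [::]).
Proof. by split=> //; rewrite inE. Qed.

Lemma explorationS H V V' anc :
  V \subset V' -> exploration H V anc -> exploration H V' anc.
Proof.
move=> /fintype.subsetP sV [r0 ra ea ca]; split=> // [|x y /ea[xV yV xy]|x y s /ca[xV yV xy]].
- exact: sV.
- by split=> //; exact: sV.
- by split=> //; exact: sV.
Qed.

Lemma exploration_old H V anc v u : explored H v u ->
  exploration H V anc -> exploration ((v, u) :: H) V anc.
Proof.
move=> vu [r0 ra ea ca]; split=> // x y; rewrite inE => /orP[/eqP[-> ->]|/ea//].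
by case/orP: vu => /ea[? ? h]; split=> //; tauto.
Qed.

Definition attach anc v u : 'I_n -> seq 'I_n :=
  fun w => if w == u then v :: anc v else anc w.

(** The new vertex becomes a leaf, so no known vertex changes its ancestors. If [v] itself is not in
    [V], then [anc v] is empty by [cons_anc] and [v] is the root of a new tree. *)
Lemma exploration_new H V anc v u : u \notin v |: V -> exploration H V anc ->
  exploration ((v, u) :: H) (u |: (v |: V)) (attach anc v u).
Proof.
move=> uV [r0 ra ea ca].
have sV w : w \in V -> w \in u |: (v |: V) by rewrite !inE => ->; rewrite !orbT.
have nu w : w \in V -> (w == u) = false.
  by move=> wV; apply: contraNF uV => /eqP <-; rewrite !inE wV orbT.
have vu : (v == u) = false by apply: contraNF uV => /eqP <-; rewrite !inE eqxx.
split.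
- exact: sV.
- by rewrite /attach nu.
- move=> x y; rewrite inE => /orP[/eqP[-> ->]|/ea[xV yV xy]].
    by rewrite /attach eqxx vu !inE !eqxx orbT; split=> //; left.
  by rewrite /attach !nu //; split=> //; exact: sV.
- move=> x y s; rewrite {1}/attach; have [->|_] := eqVneq x u.
    by case=> <- <-; rewrite /attach vu !inE !eqxx orbT.
  by move=> /ca[xV yV xy]; rewrite /attach nu //; split=> //; exact: sV.
Qed.

Lemma reduce_step_explored H V anc x y : exploration H V anc -> explored H x y ->
  reduce_step (x, anc x) y = (y, anc y).
Proof.
move=> ex xy; have {xy} : anc y = x :: anc x \/ anc x = y :: anc y.
  by case/orP: xy => /(edge_anc ex)[_ _ ?]; tauto.
rewrite /reduce_step /=; case=> [yx|->] /=; last by rewrite eqxx.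
(* With [x] the parent of [y], the vertex [y] cannot also be the parent of [x]: the sizes of the
   ancestor lists would clash. *)
case: eqP => [|_]; last by rewrite yx.
case E : (anc x) => [//|z s] /= [zy]; move: E; rewrite zy => E.
have [_ _ ys] := cons_anc ex E.
by have := congr1 size yx; rewrite ys E /=; lia.
Qed.

Lemma reduce_explored H V anc s : exploration H V anc -> path (explored H) v0 s ->
  reduce v0 s = (last v0 s, anc (last v0 s)).
Proof.
move=> ex; rewrite /reduce -[X in foldl _ (_, X)](root_anc ex).
elim: s (v0) => [//|y s IH] x /= /andP[xy /IH <-].
by rewrite (reduce_step_explored ex xy).
Qed.

End Exploration.

(** The pair is chosen before [e'], so a single unexplored edge serves for all graphs at once. *)
Lemma path_missing_step (T : Type) (e : rel T) x s : ~~ path e x s ->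
  exists a b, ~~ e a b /\ forall e' : rel T, path e' x s -> e' a b.
Proof.
elim: s x => [//|y s IH] x /=; rewrite negb_and.
case/orP => [xy|/IH[a [b [ab h]]]].
  by exists x, y; split=> // e' /andP[].
by exists a, b; split=> // e' /andP[_ /h].
Qed.

(** * Probing a random regular graph *)

Section Probing.
Variables (R : realType) (n d : nat).
Implicit Types (G : regular_graph n d) (H : seq ('I_n * 'I_n)).

Lemma probing_prob_ge0 G X (p : probing n X) e : 0 <= probing_prob R G p e.
Proof.
elim: p => [x|v k IH|k IH] /=; first exact: ler0n.
- by apply: divr_ge0; rewrite ?ler0n //; apply: sumr_ge0.
- by apply: divr_ge0; rewrite ?ler0n //; apply: sumr_ge0.
Qed.

Lemma ler_avg (I : finType) (A : pred I) (N : nat) (f : I -> R) (b : R) :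
  #|A| = N -> (0 < N)%N -> (forall i, A i -> f i <= b) ->
  (\sum_(i in A) f i) / N%:R <= b.
Proof.
move=> AN N0 fb; rewrite ler_pdivrMr ?ltr0n // mulr_natr -AN -sumr_const.
by apply: ler_sum => i; exact: fb.
Qed.

Lemma probing_prob_le1 G X (p : probing n X) e : (0 < d)%N -> (0 < n)%N ->
  probing_prob R G p e <= 1.
Proof.
move=> d0 n0; elim: p => [x|v k IH|k IH] /=; first by rewrite lern1 leq_b1.
- by apply: ler_avg; rewrite ?card_nbrs.
- by apply: ler_avg; rewrite ?card_ord.
Qed.

Lemma max_probes_bind G X Y (p : probing n X) (f : X -> probing n Y) r :
  (forall x, possible_result G p x -> max_probes G (f x) <= r)%N ->
  (max_probes G (probing_bind p f) <= max_probes G p + r)%N.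
Proof.
elim: p => [x|v k IH|k IH] /= fr; first by rewrite add0n; exact: fr.
- rewrite addSn ltnS; apply/bigmax_leqP => u uv.
  apply: (leq_trans (IH u _)) => [x ux|]; first by apply: fr; exists u.
  by rewrite leq_add2r (bigop.bigmax_sup u).
- rewrite addSn ltnS; apply/bigmax_leqP => u _.
  apply: (leq_trans (IH u _)) => [x ux|]; first by apply: fr; exists u.
  by rewrite leq_add2r (bigop.bigmax_sup u).
Qed.

Lemma max_probes_respond G S (h : S -> nat -> probing n (S * 'I_n)) (b : R) s Q :
  respects_budget G h b s Q ->
  (max_probes G (respond h s Q) <= size Q * Num.truncn b)%N.
Proof.
elim: Q s => [//|t Q IH] s /= [hb hr]; rewrite mulSn.
apply: leq_trans (max_probes_bind (r := (size Q * Num.truncn b)%N) _) _ => [r /hr/IH le|].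
  rewrite -[leqRHS]addn0; apply: leq_trans (max_probes_bind (r := 0%N) _) _ => //.
  by rewrite leq_add2r.
by rewrite leq_add2r truncn_ge_nat; [exact: ltW|exact: le_trans (ler0n _ _) (ltW hb)].
Qed.

Lemma num_extE H : (num_ext d H)%:R = \sum_(G : regular_graph n d | contains H G) 1 :> R.
Proof. by rewrite sumr_const. Qed.

(** Every graph containing [H] contains exactly [d] of the edges vu. Thus the conditional
    probabilities of the replies to a probe at [v] add up to 1. *)
Lemma sum_num_ext H v :
  \sum_u (num_ext d ((v, u) :: H))%:R = d%:R * (num_ext d H)%:R :> R.
Proof.
under eq_bigr do rewrite num_extE.
rewrite num_extE mulr_sumr (exchange_big_dep (contains H)) /=; last first.
  by move=> u G _ /andP[].
apply: eq_bigr => G GH; rewrite (eq_bigl (mem (nbrs G v))); last by move=> u; rewrite GH andbT.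
by rewrite sumr_const card_nbrs mulr1.
Qed.

End Probing.

(** * Loss of probability during an exploration *)

Local Ltac card_lia :=
  repeat match goal with |- context [#|?A|] => move: #|A| => ? end; lia.

Section BindBound.
Variables (R : realType) (n d : nat) (v0 : 'I_n) (X Y : Type).
Variables (f : X -> probing n Y) (e : regular_graph n d -> pred Y) (M K : nat).
Hypotheses (d_gt0 : (0 < d)%N) (M_small : (4 * M + 4 * (d.+1 * d) <= n * d)%N).

Implicit Types (G : regular_graph n d) (H : seq ('I_n * 'I_n)).

Local Notation loss := (2%:R * K%:R / n%:R : R).

Let n_gt0 : (0 < n)%N. Proof. exact: leq_ltn_trans (ltn_ord v0). Qed.

Let nR : 0 < n%:R :> R. Proof. by rewrite ltr0n. Qed.

Let dR : 0 < d%:R :> R. Proof. by rewrite ltr0n. Qed.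

Lemma ler_num_ext_edge H u v : ~~ explored H u v -> (size H <= M)%N ->
  (num_ext d ((u, v) :: H))%:R <= 2%:R * d%:R / n%:R * (num_ext d H)%:R :> R.
Proof.
rewrite negb_or => /andP[uvH vuH] HM.
rewrite mulrAC ler_pdivlMr // [leLHS]mulrC -!natrM ler_nat.
by apply: num_ext_edge => //; lia.
Qed.

(** Deferred decisions: a sum over the graphs containing [H] is an unnormalised expectation given
    the replies so far. A neighbour probe repeats a seen edge, attaches a leaf, or closes an unseen
    edge onto one of at most [K] known vertices. The last event has conditional probability at most
    [loss], whence [q] losses for [q] probes. The continuation [f] receives what the next stage
    needs: frozen ancestors of [V], and depth increased by at most [q]. *)
Lemma probing_bind_bound p H V anc q (beta : R) :
  exploration v0 H V anc -> 0 <= beta ->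
  (forall G, contains H G -> max_probes G p <= q)%N ->
  (size H + q <= M)%N -> (#|V| + 2 * q <= K)%N ->
  (forall x H' V' anc', exploration v0 H' V' anc' ->
     (size H' <= size H + q)%N -> (#|V'| <= #|V| + 2 * q)%N ->
     {in V, anc' =1 anc} ->
     (forall l, (forall w, size (anc w) <= l)%N ->
        forall w, size (anc' w) <= l + q)%N ->
     (forall G, contains H' G -> contains H G) ->
     (forall G, contains H' G -> possible_result G p x) ->
     \sum_(G : regular_graph n d | contains H' G) probing_prob R G (f x) (e G)
       <= beta * (num_ext d H')%:R) ->
  \sum_(G : regular_graph n d | contains H G) probing_prob R G (probing_bind p f) (e G)
    <= (beta + q%:R * loss) * (num_ext d H)%:R.
Proof.
have loss0 : 0 <= loss by rewrite divr_ge0 ?mulr_ge0 ?ler0n.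
elim: p H V anc q => [x|v k IH|k IH] H V anc q ex beta0 pq HM VK fb /=.
- apply: le_trans (fb x H V anc ex _ _ _ _ _ _) _ => //; try by lia.
  + by move=> l le w; rewrite (leq_trans (le w)) // leq_addr.
  + by rewrite ler_wpM2r ?ler0n // lerDl mulr_ge0.
(* If no graph contains [H], both sides vanish; otherwise such a graph shows that [q] is
   positive. *)
- case: (posnP (num_ext d H)) => [W0|/card_gt0P[G0 GH0]].
    by rewrite W0 mulr0 big_pred0 // => G; exact: (card0_eq W0).
  case: q => [|q] in pq HM VK fb *; first by have := pq _ GH0.
  pose A u G := probing_prob R G (probing_bind (k u) f) (e G).
  have -> : \sum_(G | contains H G) (\sum_(u in nbrs G v) A u G) / #|nbrs G v|%:R =
      d%:R^-1 * \sum_u \sum_(G | contains ((v, u) :: H) G) A u G.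
    under eq_bigr do rewrite card_nbrs mulrC.
    rewrite -mulr_sumr (exchange_big_dep predT) //=; congr (_ * _).
    by apply: eq_bigr => u _; apply: eq_bigl => G; rewrite andbC.
  (* The second summand pays for the bad replies, on which the success probability is bounded by
     1. *)
  have step u : \sum_(G | contains ((v, u) :: H) G) A u G <=
      (beta + q%:R * loss) * (num_ext d ((v, u) :: H))%:R
      + (u \in v |: V)%:R * (2%:R * d%:R / n%:R * (num_ext d H)%:R).
    have c0 : 0 <= 2%:R * d%:R / n%:R * (num_ext d H)%:R :> R.
      by rewrite !mulr_ge0 ?invr_ge0 ?ler0n.
    have pq' G : contains ((v, u) :: H) G -> (max_probes G (k u) <= q)%N.
      case/andP => /= uv GH; have := pq _ GH; rewrite /= ltnS => le.
      by rewrite (leq_trans _ le) // (bigop.bigmax_sup u).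
    have [vu|nvu] := boolP (explored H v u).
      rewrite -[leLHS]addr0 lerD ?mulr_ge0 ?ler0n //.
      apply: (IH u _ V anc) => //=; first exact: exploration_old.
      + lia.
      + move: VK; card_lia.
      + move=> x H' V' anc' ex' H'H V'V an sz sub pos.
        apply: (fb x H' V' anc') => //; first by lia.
        * move: V'V; card_lia.
        * by move=> l le w; rewrite (leq_trans (sz l le w)) // addnS.
        * by move=> G /sub/andP[].
        * by move=> G GH'; exists u; [case/andP: (sub _ GH')|exact: pos].
    have [uV|uV] := boolP (u \in v |: V); last first.
      have uNV : u \notin V by apply: contraNN uV; rewrite inE => ->; rewrite orbT.
      rewrite mul0r addr0.
      have cV : (#|u |: (v |: V)| <= #|V| + 2)%N by rewrite !cardsU1; card_lia.
      apply: (IH u _ (u |: (v |: V)) (attach anc v u)) => //=; first exact: exploration_new.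
      + lia.
      + move: VK cV; card_lia.
      + move=> x H' V' anc' ex' H'H V'V an sz sub pos.
        apply: (fb x H' V' anc') => //; first by lia.
        * move: V'V cV; card_lia.
        * move=> w wV; rewrite an ?inE ?wV ?orbT // /attach.
          by rewrite ifN //; apply: contraNneq uNV => <-.
        * move=> l le w; rewrite addnS -addSn; apply: sz => {}w.
          by rewrite /attach; case: ifP => _ /=; [rewrite ltnS|rewrite leqW].
        * by move=> G /sub/andP[].
        * by move=> G GH'; exists u; [case/andP: (sub _ GH')|exact: pos].
    rewrite mul1r -[leLHS]add0r lerD //.
      by rewrite mulr_ge0 ?ler0n // addr_ge0 // mulr_ge0 ?ler0n.
    apply: le_trans (ler_num_ext_edge nvu _); last by lia.
    by rewrite num_extE; apply: ler_sum => G _; exact: probing_prob_le1.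
  apply: le_trans (ler_wpM2l _ (ler_sum _ (fun u _ => step u))) _.
    by rewrite invr_ge0 ler0n.
  rewrite big_split /= -mulr_sumr sum_num_ext -mulr_suml -natr_sum.
  have -> : (\sum_u (u \in v |: V) = #|v |: V|)%N by rewrite -sum1_card [RHS]big_mkcond.
  set c := #|_|; have cK : c%:R <= K%:R :> R.
    by rewrite ler_nat /c (leq_trans _ VK) // cardsU1; card_lia.
  rewrite -[q.+1%:R]natr1; set W := (num_ext d H)%:R.
  have -> : (beta + (q%:R + 1) * loss) * W = (beta + q%:R * loss) * W + loss * W by ring.
  have -> : d%:R^-1 * ((beta + q%:R * loss) * (d%:R * W) + c%:R * (2%:R * d%:R / n%:R * W)) =
      (beta + q%:R * loss) * W + 2%:R * c%:R / n%:R * W.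
    by field; rewrite !gt_eqF.
  rewrite lerD2l ler_wpM2r ?ler0n // ler_wpM2r ?invr_ge0 ?ler0n //.
  by rewrite ler_wpM2l // ler0n.
(* A random vertex reveals no edge: [H], [V] and [anc] stay as they are. *)
- have qn G : contains H G -> (0 < q)%N by move=> /pq; apply: leq_ltn_trans.
  case: (posnP (num_ext d H)) => [W0|/card_gt0P[G0 GH0]].
    by rewrite W0 mulr0 big_pred0 // => G; exact: (card0_eq W0).
  case: q => [|q] in pq HM VK fb qn *; first by have := qn _ GH0.
  rewrite -mulr_suml exchange_big /=.
  apply: ler_avg; rewrite ?card_ord // => u _.
  apply: le_trans (_ : (beta + q%:R * loss) * (num_ext d H)%:R <= _); last first.
    by rewrite ler_wpM2r ?ler0n // lerD2l ler_wpM2r // ler_nat.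
  apply: (IH u H V anc) => //.
  + move=> G /pq; rewrite /= ltnS; apply: leq_trans.
    by rewrite (bigop.bigmax_sup u).
  + lia.
  + move: VK; card_lia.
  + move=> x H' V' anc' ex' H'H V'V an sz sub pos.
    apply: (fb x H' V' anc') => //; first by lia.
    * move: V'V; card_lia.
    * by move=> l le w; rewrite (leq_trans (sz l le w)) // addnS.
    * by move=> G GH'; exists u; exact: pos.
Qed.

End BindBound.

Definition adj n d (G : regular_graph n d) : rel 'I_n := fun x y => y \in nbrs G x.

(* The first answer is the end of the walk, hence the rotation. *)
Definition accepts (R : realType) n d (b : R) (v0 : 'I_n) (G : regular_graph n d)
    (xs : seq 'I_n) : bool :=
  path (adj G) v0 (rot 1 xs) && (b < (size (reduce v0 (rot 1 xs)).2)%:R).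

(** The exploration bound is applied to the first query and then to the remaining ones. The number 2
    + 2q counts the root, the first answer and two vertices per probe. The term 2d/n covers a walk
    that uses an unexplored edge. *)
Lemma probing_prob_accepts_bound (R : realType) n d (v0 : 'I_n) (S : Type)
    (h : S -> nat -> probing n (S * 'I_n)) (b : R) s t (Q : seq nat)
    (q := ((size Q).+1 * Num.truncn b)%N) :
  (0 < d)%N -> 0 <= b -> (4 * q + 4 * (d.+1 * d) <= n * d)%N ->
  (forall G : regular_graph n d, respects_budget G h b s (t :: Q)) ->
  \sum_(G : regular_graph n d)
     probing_prob R G (respond h s (t :: Q)) (accepts b v0 G)
    <= (2%:R * d%:R / n%:R + q%:R * (2%:R * (2 + 2 * q)%N%:R / n%:R))
       * #|{: regular_graph n d}|%:R.
Proof.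
move=> d0 b0 big hb; set l := Num.truncn b.
have -> : #|{: regular_graph n d}| = num_ext d ([::] : seq ('I_n * 'I_n)).
  by apply: eq_card => G; rewrite !inE.
have eps0 : 0 <= 2%:R * d%:R / n%:R :> R by rewrite !mulr_ge0 ?invr_ge0 ?ler0n.
have loss0 : 0 <= 2%:R * (2 + 2 * q)%N%:R / n%:R :> R.
  by rewrite !mulr_ge0 ?invr_ge0 ?ler0n.
have -> : 2%:R * d%:R / n%:R + q%:R * (2%:R * (2 + 2 * q)%N%:R / n%:R) =
    (2%:R * d%:R / n%:R + (size Q * l)%N%:R * (2%:R * (2 + 2 * q)%N%:R / n%:R))
    + l%:R * (2%:R * (2 + 2 * q)%N%:R / n%:R) :> R.
  by rewrite {1}/q mulSn natrD; ring.
have q_sum : q = (l + size Q * l)%N by rewrite /q mulSn.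
apply: (probing_bind_bound (v0 := v0) (M := q) d0 big (exploration0 v0)) => //.
- by move=> G _; have [hG _] := hb G; rewrite truncn_ge_nat // ltW.
- by rewrite q_sum leq_addr.
- by rewrite cards1 q_sum; lia.
move=> [s' x] H1 V1 anc1 ex1 sH1 cV1 _ szanc1 _ pos1 /=.
rewrite add0n cards1 in sH1 cV1.
have lx : (size (anc1 x) <= l)%N by rewrite -[l]add0n szanc1.
(* Declaring the first answer known freezes its ancestors, hence its depth, during the remaining
   queries. *)
apply: (probing_bind_bound (v0 := v0) (M := q) (V := x |: V1) (anc := anc1) d0 big) => //.
- by apply: explorationS ex1; exact: finset.subsetUr.
- move=> G /pos1; have [_ hG] := hb G => /hG; exact: max_probes_respond.
- by rewrite q_sum; lia.
- have : (#|x |: V1| <= #|V1|.+1)%N by rewrite cardsU1 -add1n leq_add2r leq_b1.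
  by move: cV1; rewrite q_sum; move: #|V1| #|x |: V1| (size Q * l)%N => ? ? ?; lia.
move=> xs H2 V2 anc2 ex2 sH2 _ an2 _ _ _ /=.
have [pH|] := boolP (path (explored H2) v0 (rcons xs x)).
  rewrite big1 => [|G _]; first by rewrite mulr_ge0.
  rewrite /accepts rot1_cons (reduce_explored ex2 pH) last_rcons /=.
  rewrite an2 ?inE ?eqxx // [_ < _]negbTE ?andbF //.
  by rewrite -leNgt (le_trans _ (_ : l%:R <= b)) ?ler_nat ?truncn_le.
move=> npH; have [a [c [ac hp]]] := path_missing_step npH.
apply: le_trans (ler_num_ext_edge R v0 d0 big ac _); last first.
  by rewrite q_sum; lia.
rewrite num_extE big_mkcond [leRHS]big_mkcond /=; apply: ler_sum => G _.
case: (contains H2 G); rewrite ?andbF // andbT.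
rewrite /accepts rot1_cons; case: (boolP (path _ _ _)) => [/hp aG|_ /=].
  by rewrite -[_ \in _]/(adj G a c) aG lern1 leq_b1.
by case: ifP.
Qed.

(** * The random walk *)

Section Walk.
Variables (R : realType) (n d : nat) (G : regular_graph n d) (v0 : 'I_n).
Hypotheses (v00 : val v0 = 0%N) (d3 : (3 <= d)%N).

Definition trajectory T (w : {ffun 'I_T.+1 -> 'I_n}) : seq 'I_n :=
  [seq w (inord t) | t <- iota 1 T].

Definition extend T (w : {ffun 'I_T.+1 -> 'I_n}) (y : 'I_n) :
    {ffun 'I_T.+2 -> 'I_n} :=
  [ffun i => if unlift ord_max i is Some j then w j else y].

Lemma extend_old T (w : {ffun 'I_T.+1 -> 'I_n}) y t : (t <= T)%N ->
  extend w y (inord t) = w (inord t).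
Proof.
move=> tT; rewrite ffunE.
have -> : inord t = lift ord_max (inord t : 'I_T.+1).
  by apply: val_inj; rewrite /= /bump !inordK ?ltnS //; lia.
by rewrite liftK.
Qed.

Lemma extend_new T (w : {ffun 'I_T.+1 -> 'I_n}) y :
  extend w y (inord T.+1) = y.
Proof.
rewrite ffunE; have -> : inord T.+1 = ord_max :> 'I_T.+2.
  by apply: val_inj; rewrite /= inordK.
by rewrite unlift_none.
Qed.

Lemma sum_extend T (g : {ffun 'I_T.+2 -> 'I_n} -> R) :
  \sum_w g w = \sum_w \sum_y g (extend w y).
Proof.
rewrite pair_big /=.
pose f (p : {ffun 'I_T.+1 -> 'I_n} * 'I_n) := extend p.1 p.2.
rewrite (reindex f) //=; exists (fun w => ([ffun i => w (lift ord_max i)], w ord_max)).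
- move=> [w y] _ /=; rewrite !ffunE unlift_none; congr (_, _).
  by apply/ffunP => i; rewrite !ffunE liftK.
- move=> w _; apply/ffunP => i; rewrite ffunE /=.
  by case: unliftP => [j ->|->]; rewrite ?ffunE.
Qed.

Lemma walk_prob_extend T (w : {ffun 'I_T.+1 -> 'I_n}) y :
  walk_prob R G (extend w y) = walk_prob R G w * walk_step R G (w (inord T)) y.
Proof.
rewrite /walk_prob big_ord_recr /= mulrA extend_old // extend_new.
have -> : extend w y ord0 = w ord0.
  have := extend_old w y (leq0n T).
  by congr (_ = _); congr (_ _); apply: val_inj; rewrite /= inordK.
congr (_ * _ * _); apply: eq_bigr => t _ /=.
by rewrite !extend_old // ltnW.
Qed.

Lemma trajectory_extend T (w : {ffun 'I_T.+1 -> 'I_n}) y :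
  trajectory (extend w y) = rcons (trajectory w) y.
Proof.
rewrite /trajectory; have -> : iota 1 T.+1 = rcons (iota 1 T) T.+1.
  by rewrite -[T.+1 in LHS]addn1 iotaD cats1 add1n.
rewrite map_rcons extend_new.
congr rcons; apply/eq_in_map => t; rewrite mem_iota => /andP[_ tT].
by rewrite extend_old // -ltnS.
Qed.

Lemma walk_prob_ge0 T (w : {ffun 'I_T.+1 -> 'I_n}) : 0 <= walk_prob R G w.
Proof.
rewrite /walk_prob mulr_ge0 ?ler0n // prodr_ge0 // => t _.
by rewrite divr_ge0 ?ler0n.
Qed.

Let dR : 0 < d%:R :> R. Proof. by rewrite ltr0n; lia. Qed.

Lemma walk_step_sum u : \sum_v walk_step R G u v = 1.
Proof.
rewrite /walk_step -mulr_suml card_nbrs -natr_sum.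
have -> : (\sum_v (v \in nbrs G u) = #|nbrs G u|)%N by rewrite -sum1_card [RHS]big_mkcond.
by rewrite card_nbrs divff // gt_eqF.
Qed.

Lemma walk_prob0E (w : {ffun 'I_1 -> 'I_n}) : walk_prob R G w = (w == [ffun=> v0])%:R.
Proof.
rewrite /walk_prob big_ord0 mulr1; congr (nat_of_bool _)%:R.
apply/eqP/eqP => [w0|->]; last by rewrite ffunE.
by apply/ffunP => i; rewrite ffunE ord1; apply: val_inj; rewrite w0.
Qed.

Lemma walk_prob_sum T : \sum_(w : {ffun 'I_T.+1 -> 'I_n}) walk_prob R G w = 1.
Proof.
elim: T => [|T IH].
  rewrite (bigD1 [ffun=> v0]) //= walk_prob0E eqxx big1 ?addr0 // => w /negbTE h.
  by rewrite walk_prob0E h.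
rewrite sum_extend -[RHS]IH; apply: eq_bigr => w _.
by under eq_bigr do rewrite walk_prob_extend; rewrite -mulr_sumr walk_step_sum mulr1.
Qed.

Lemma reduce1 (s : seq 'I_n) : (reduce v0 s).1 = last v0 s.
Proof.
case/lastP: s => [//|s y]; rewrite /reduce foldl_rcons last_rcons /reduce_step.
by case: ifP.
Qed.

(** This makes the top of the stack a neighbour of the current vertex, so that a backtrack has
    probability exactly 1/d. *)
Lemma reduce_path (s : seq 'I_n) : path (adj G) v0 s ->
  path (adj G) (reduce v0 s).1 (reduce v0 s).2.
Proof.
elim/last_ind: s => [//|s y IH]; rewrite rcons_path -reduce1 => /andP[/IH].
rewrite /reduce foldl_rcons -/(reduce v0 s); case: (reduce v0 s) => x [|z r].
  by rewrite /reduce_step /= => _ xy; rewrite andbT /adj nbrs_sym.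
rewrite /reduce_step /=; case: eqP => [[->] /andP[]//|_ /= -> xy].
by rewrite andbT /adj nbrs_sym.
Qed.

Lemma walk_prob_neq0 T (w : {ffun 'I_T.+1 -> 'I_n}) : walk_prob R G w != 0 ->
  path (adj G) v0 (trajectory w) /\ last v0 (trajectory w) = w (inord T).
Proof.
elim: T w => [w|T IH w].
  rewrite walk_prob0E; have [-> _|_] := eqVneq w [ffun=> v0]; last by rewrite eqxx.
  by rewrite /= ffunE.
have [w' [y ->]] : exists w' y, w = extend w' y.
  exists [ffun i => w (lift ord_max i)], (w ord_max); apply/ffunP => i.
  by rewrite ffunE; case: unliftP => [j ->|->]; rewrite ?ffunE.
rewrite walk_prob_extend mulf_eq0 negb_or trajectory_extend extend_new.
case/andP => /IH[pw lw] st; rewrite rcons_path last_rcons pw lw; split=> //=.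
by move: st; rewrite /walk_step /adj; case: (y \in _) => //; rewrite mul0r eqxx.
Qed.

(* A step from a nonempty reduced walk backtracks with probability 1/d <= 1/3, and
   17/18 = (1/3)(3/2) + (2/3)(2/3). *)
Lemma reduce_step_potential x r : path (adj G) x r ->
  \sum_y walk_step R G x y * (2%:R / 3%:R) ^+ size (reduce_step (x, r) y).2
    <= 17%:R / 18%:R * (2%:R / 3%:R) ^+ size r.
Proof.
set lam : R := 2%:R / 3%:R.
case: r => [_|z r /= /andP[xz _]].
  by rewrite /= -mulr_suml walk_step_sum expr0 expr1 /lam; lra.
(* Every step is counted as a push, and the one step to [z] is then corrected to a pop. *)
have E y : walk_step R G x y * lam ^+ size (reduce_step (x, z :: r) y).2 =
    walk_step R G x y * lam ^+ (size r).+2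
    + (if y == z then walk_step R G x y * (lam ^+ size r - lam ^+ (size r).+2) else 0).
  rewrite /reduce_step /= (inj_eq Some_inj) eq_sym.
  by case: (y == z) => /=; ring.
under eq_bigr do rewrite E.
rewrite big_split /= -mulr_suml walk_step_sum -big_mkcond big_pred1_eq.
rewrite /walk_step (_ : z \in _) // card_nbrs !exprS.
have : lam ^+ size r >= 0 by rewrite exprn_ge0 // /lam; lra.
have : d%:R^-1 <= 3%:R^-1 :> R by rewrite lef_pV2 ?posrE ?ler_nat // ltr0n.
set D := d%:R^-1; set L := lam ^+ _ => D3 L0.
have -> : true%:R = 1 :> R by [].
suff : 0 <= (3%:R^-1 - D) * L by rewrite /lam; lra.
by rewrite mulr_ge0 // subr_ge0.
Qed.

Lemma walk_potential T :
  \sum_(w : {ffun 'I_T.+1 -> 'I_n})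
     walk_prob R G w * (2%:R / 3%:R) ^+ size (reduce v0 (trajectory w)).2
    <= (17%:R / 18%:R) ^+ T.
Proof.
elim: T => [|T IH].
  rewrite expr0 -[leRHS](walk_prob_sum 0); apply: ler_sum => w _.
  by rewrite /= expr0 mulr1.
rewrite sum_extend exprS; apply: le_trans (_ : 17%:R / 18%:R * _ <= _); last first.
  by apply: ler_wpM2l IH; lra.
rewrite mulr_sumr; apply: ler_sum => w _.
have [w0|w0] := eqVneq (walk_prob R G w) 0.
  by rewrite w0 mul0r mulr0 big1 // => y _; rewrite walk_prob_extend w0 !mul0r.
have [pw lw] := walk_prob_neq0 w0.
rewrite (eq_bigr (fun y => walk_prob R G w * (walk_step R G (reduce v0 (trajectory w)).1 y *
    (2%:R / 3%:R) ^+ size (reduce_step (reduce v0 (trajectory w)) y).2))); last first.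
  move=> y _; rewrite walk_prob_extend trajectory_extend mulrA reduce1 lw.
  by rewrite /reduce foldl_rcons.
rewrite -mulr_sumr mulrCA ler_wpM2l ?walk_prob_ge0 //.
move: (reduce_path pw); case: (reduce _ _) => x r; exact: reduce_step_potential.
Qed.

(** Markov's inequality for the potential: when the reduced length is at most [l], the potential
    times (3/2)^l is at least 1. *)
Lemma accepted_walk_prob T (l : nat) :
  1 - (3%:R / 2%:R) ^+ l * (17%:R / 18%:R) ^+ T <=
  \sum_(w : {ffun 'I_T.+1 -> 'I_n}) walk_prob R G w *
    (path (adj G) v0 (trajectory w) && (l < size (reduce v0 (trajectory w)).2)%N)%:R.
Proof.
apply: le_trans (lerB (lexx 1) (ler_wpM2l _ (walk_potential T))) _.
  by rewrite exprn_ge0.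
rewrite -[X in X - _](walk_prob_sum T) mulr_sumr -sumrB; apply: ler_sum => w _.
have [->|w0] := eqVneq (walk_prob R G w) 0; first by rewrite !mul0r mulr0 subr0.
have [-> _] := walk_prob_neq0 w0; rewrite /= mulrCA -{1}[walk_prob R G w]mulr1 -mulrBr.
rewrite ler_wpM2l ?walk_prob_ge0 //; set D := size _.
have [_|Dl] := ltnP l D; first by rewrite lerBlDr lerDl mulr_ge0 ?exprn_ge0.
rewrite subr_le0 -(subnK Dl) exprD -mulrA -exprMn.
have -> : 3%:R / 2%:R * (2%:R / 3%:R) = 1 :> R by field.
by rewrite expr1n mulr1 exprn_ege1 //; lra.
Qed.

End Walk.

(** * Laws of the answers *)

(** A bound valid for each seed survives averaging over seeds, which reduces a randomised algorithm
    to its fixed-seed versions. *)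
Lemma sum_Rintegral_le (R : realType) (dp : measure_display) (T : measurableType dp)
    (P : probability T R) (I : finType) (g : I -> T -> R) (c : I -> R) (B : R) :
  (forall i, measurable_fun setT (g i)) -> (forall i w, 0 <= g i w <= 1) ->
  (forall w, \sum_i g i w * c i <= B) ->
  \sum_i Rintegral P setT (g i) * c i <= B.
Proof.
move=> mg g01 gB.
have PT : fine (P setT) = 1 by rewrite probability_setT.
have ig i : P.-integrable setT (EFin \o g i).
  apply: measurable_bounded_integrable => //; first by rewrite fin_num_fun_lty.
  exists 1; split=> // M M1 w _; case/andP: (g01 i w) => g0 g1.
  by rewrite /= ger0_norm // (le_trans g1 (ltW M1)).
have cst_int (r : R) : P.-integrable setT (EFin \o (fun=> r)).
  by apply: finite_measure_integrable_cst.
have [iS <-] : P.-integrable setT (EFin \o (fun w => \sum_i g i w * c i)) /\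
    Rintegral P setT (fun w => \sum_i g i w * c i) = \sum_i Rintegral P setT (g i) * c i.
  elim: (index_enum I) => [|i s [IHi IHe]].
    have -> : (fun w => \sum_(i <- [::]) g i w * c i) = (fun=> 0 : R).
      by apply/funext => w; rewrite big_nil.
    by rewrite big_nil Rintegral_cst // mul0r.
  have -> : (fun w => \sum_(j <- i :: s) g j w * c j) =
      (fun w => g i w * c i + \sum_(j <- s) g j w * c j).
    by apply/funext => w; rewrite big_cons.
  have igc : P.-integrable setT (EFin \o (fun w => g i w * c i)).
    by have := integrableZr (measurableT) (c i) (ig i).
  split; first by have := integrableD (measurableT) igc IHi.
  by rewrite RintegralD // IHe RintegralZr // big_cons.
apply: le_trans (le_Rintegral (measurableT) iS (cst_int B) _) _ => [w _|]; first exact: gB.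
by rewrite Rintegral_cst // PT mulr1.
Qed.

(** Only an inequality, since results whose length differs from [m] are lost on the left. *)
Lemma sum_probing_prob_pred1 (R : realType) n d (G : regular_graph n d) m
    (p : probing n (seq 'I_n)) (F : pred (seq 'I_n)) :
  \sum_(x : m.-tuple 'I_n) probing_prob R G p (pred1 (tval x)) * (F x)%:R
    <= probing_prob R G p F.
Proof.
elim: p => [y|v k IH|k IH] /=.
- have [ym|ym] := eqVneq (size y) m; last first.
    rewrite big1 ?ler0n // => x _; rewrite (negbTE (_ : y != x)) ?mul0r //.
    by apply: contraNneq ym => ->; rewrite size_tuple.
  rewrite (bigD1 (Tuple (introT eqP ym))) //= eqxx mul1r big1 ?addr0 // => x xy.
  rewrite (negbTE (_ : y != x)) ?mul0r //; apply: contraNneq xy => yx.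
  by apply/eqP/val_inj; rewrite /= yx.
- under eq_bigr do rewrite mulrAC mulr_suml.
  rewrite -mulr_suml exchange_big /= ler_wpM2r ?invr_ge0 ?ler0n //.
  exact: ler_sum.
- under eq_bigr do rewrite mulrAC mulr_suml.
  rewrite -mulr_suml exchange_big /= ler_wpM2r ?invr_ge0 ?ler0n //.
  exact: ler_sum.
Qed.

Lemma bernoulli_ineq (R : realDomainType) (x : R) n : 0 <= x -> 1 + n%:R * x <= (1 + x) ^+ n.
Proof.
move=> x0; elim: n => [|n IH]; first by rewrite mul0r addr0 expr0.
rewrite exprS -natr1; apply: le_trans (ler_wpM2l _ IH); last by rewrite addr_ge0.
have : 0 <= n%:R * x * x by rewrite !mulr_ge0.
lra.
Qed.

(** * The query sequence and the acceptance probabilities *)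

Definition end_first_seq (m : nat) : seq nat :=
  if m is m'.+1 then m :: iota 1 m' else [::].

Lemma size_end_first m : size (end_first_seq m) == m.
Proof. by case: m => [//|m]; rewrite /= size_iota. Qed.

Definition end_first m : m.-tuple nat := Tuple (size_end_first m).

Lemma uniq_end_first m : uniq (end_first m).
Proof. by case: m => [//|m] /=; rewrite iota_uniq mem_iota andbT; lia. Qed.

Lemma horizon_end_first m : horizon (end_first m) = m.
Proof.
rewrite /horizon -(big_tuple _ _ (end_first m) xpredT id).
case: m => [|m] /=; first by rewrite big_nil.
apply/eqP; rewrite eqn_leq; apply/andP; split; last by rewrite big_cons leq_max leqnn.
rewrite big_cons geq_max leqnn /=; apply/bigmax_leqP_seq => t.
by rewrite mem_iota; lia.
Qed.

(** A walk determines its answer tuple, so after exchanging sums a single tuple remains for each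
    walk. *)
Lemma expect_bool_walk_law (R : realType) n d (G : regular_graph n d) m
    (Q : m.-tuple nat) (F : pred (seq 'I_n)) :
  expect_bool (fun x => F (tval x)) (walk_law R G Q) =
  \sum_(w : {ffun 'I_(horizon Q).+1 -> 'I_n})
     walk_prob R G w * (F [seq w (inord t) | t <- Q])%:R.
Proof.
rewrite /expect_bool /walk_law; under eq_bigr do rewrite mulr_suml.
rewrite (exchange_big_dep predT) //=; apply: eq_bigr => w _.
rewrite (eq_bigl (pred1 [tuple of [seq w (inord t) | t <- Q]])); first by rewrite big_pred1_eq.
move=> x /=; apply/forallP/eqP => [h|-> i]; last by rewrite tnth_map.
by apply: eq_from_tnth => i; rewrite tnth_map; apply/esym/eqP.
Qed.

Lemma rot_end_first m : (0 < m)%N -> rot 1 (end_first_seq m) = iota 1 m.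
Proof.
by case: m => [//|m] _; rewrite rot1_cons -[m.+1 in RHS]addn1 iotaD cats1 add1n.
Qed.

Lemma expect_accepted_walk (R : realType) n d (G : regular_graph n d) (v0 : 'I_n)
    (b : R) m :
  (3 <= d)%N -> val v0 = 0%N -> (0 < m)%N ->
  1 - (3%:R / 2%:R) ^+ Num.truncn b * (17%:R / 18%:R) ^+ m <=
  expect_bool (fun x => accepts b v0 G (tval x)) (walk_law R G (end_first m)).
Proof.
move=> d3 v00 m0; rewrite expect_bool_walk_law.
rewrite -[X in (17%:R / 18%:R) ^+ X](horizon_end_first m).
apply: le_trans (accepted_walk_prob R G v00 d3 _ _) _.
apply: ler_sum => w _; rewrite ler_wpM2l ?walk_prob_ge0 // ler_nat /accepts.
rewrite -map_rot rot_end_first // -[X in iota 1 X](horizon_end_first m) -/(trajectory w).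
case: (path _ _ _) => //=; case: (ltnP _ _) => //= h.
by rewrite (lt_le_trans (truncnS_gt b)) // ler_nat.
Qed.

Lemma expect_accepted_responses (R : realType) n d (v0 : 'I_n)
    (A : algorithm R n d) (b : R) m (q := (m * Num.truncn b)%N) :
  (0 < d)%N -> 0 <= b -> (0 < m)%N -> (4 * q + 4 * (d.+1 * d) <= n * d)%N ->
  probes_per_query_lt A (end_first m) b ->
  \sum_(G : regular_graph n d)
     expect_bool (fun x => accepts b v0 G (tval x)) (response_law G A (end_first m))
    <= (2%:R * d%:R / n%:R + q%:R * (2%:R * (2 + 2 * q)%N%:R / n%:R))
       * #|{: regular_graph n d}|%:R.
Proof.
move=> d0 b0 m0 big hA; have n0 : (0 < n)%N := leq_ltn_trans (leq0n _) (ltn_ord v0).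
rewrite /expect_bool /response_law pair_big /=.
pose g (z : regular_graph n d * m.-tuple 'I_n) (w : alg_seed A) :=
  probing_prob R z.1 (respond (alg_query w) (alg_init A) (end_first m)) (pred1 (tval z.2)).
apply: (@sum_Rintegral_le _ _ _ (alg_law A) _ g (fun z => (accepts b v0 z.1 z.2)%:R)).
- by move=> z; exact: alg_measurable.
- by move=> z w; rewrite probing_prob_ge0 probing_prob_le1.
move=> w; rewrite -(pair_big predT predT
  (fun G (x : m.-tuple 'I_n) => g (G, x) w * (accepts b v0 G x)%:R)) /=.
apply: le_trans (ler_sum _ (fun G _ => sum_probing_prob_pred1 R G m _ (accepts b v0 G))) _.
case: m m0 @q big hA g => [//|m] _ q big hA _ /=.
have := @probing_prob_accepts_bound R n d v0 _ (alg_query w) b (alg_init A) m.+1 (iota 1 m) d0 b0.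
rewrite size_iota; apply=> // G; exact: hA.
Qed.

(* By Bernoulli's inequality (18/17)^9 >= 3/2 and (18/17)^3400 >= 200. *)
Lemma walk_error_small (R : realFieldType) l m : (9 * l + 3400 <= m)%N ->
  (3%:R / 2%:R) ^+ l * (17%:R / 18%:R) ^+ m <= 200%:R^-1 :> R.
Proof.
move=> lm; have lm9 : (9 * l <= m)%N by lia.
rewrite -(subnKC lm9) exprD exprM mulrA -exprMn; set j := (m - _)%N.
have b9 := @bernoulli_ineq R (17%:R^-1) 9 ltac:(lra).
have bj := @bernoulli_ineq R (17%:R^-1) j ltac:(lra).
have j3400 : 3400%:R <= j%:R :> R by rewrite ler_nat /j; lia.
have e : 17%:R / 18%:R = (1 + 17%:R^-1)^-1 :> R by field.
have small : 3%:R / 2%:R * (17%:R / 18%:R) ^+ 9 <= 1 :> R.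
  by rewrite e exprVn ler_pdivrMr ?exprn_gt0 ?mul1r; lra.
rewrite -[leRHS]mul1r ler_pM ?exprn_ge0 ?mulr_ge0 //; try lra.
  by rewrite exprn_ile1 // mulr_ge0 ?exprn_ge0 //; lra.
by rewrite e exprVn lef_pV2 ?posrE ?exprn_gt0; lra.
Qed.

Lemma powR_fourth_root (R : realType) n : (n%:R `^ 4^-1 : R) ^+ 4 = n%:R.
Proof. by rewrite -powR_mulrn ?powR_ge0 // -powRrM mulVf ?powRr1 ?ler0n // pnatr_eq0. Qed.

(** Here [r] is the fourth root of n and [q] bounds the total number of probes. The main error term
    4q^2/r^4 is at most 1/2500; the others are of lower order. The second conclusion is the size
    condition of the switching argument. *)
Lemma response_error_small (R : realFieldType) (r d q : R) :
  3%:R <= d -> 4000%:R + 100%:R * d <= r -> 0 <= q -> q <= r ^+ 2 / 100%:R ->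
  2%:R * d / r ^+ 4 + q * (2%:R * (2%:R + 2%:R * q) / r ^+ 4) <= 200%:R^-1 /\
  4%:R * q + 4%:R * ((d + 1) * d) <= r ^+ 4 * d.
Proof.
move=> d3 rA q0 qr.
have r2 : 4000%:R * r <= r ^+ 2 by rewrite expr2 ler_wpM2r; lra.
have r4 : 4000%:R * r ^+ 2 <= r ^+ 4.
  have -> : r ^+ 4 = r ^+ 2 * r ^+ 2 by ring.
  by rewrite ler_wpM2r ?sqr_ge0 //; lra.
have q2 : q ^+ 2 <= r ^+ 4 / 10000%:R.
  have -> : r ^+ 4 / 10000%:R = (r ^+ 2 / 100%:R) ^+ 2 by field.
  by rewrite ler_pXn2r ?nnegrE //; lra.
have r40 : 0 < r ^+ 4 by rewrite exprn_gt0; lra.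
split.
  have -> : 2%:R * d / r ^+ 4 + q * (2%:R * (2%:R + 2%:R * q) / r ^+ 4) =
      (2%:R * d + 4%:R * q + 4%:R * q ^+ 2) / r ^+ 4 by field; rewrite gt_eqF; lra.
  by rewrite ler_pdivrMr //; lra.
have : r ^+ 4 * 3%:R <= r ^+ 4 * d by rewrite ler_wpM2l // ltW.
have : (d + 1) * d <= r * r by rewrite ler_pM; lra.
rewrite -expr2; lra.
Qed.

Theorem theorem4p20 (R : realType) (d : nat) (hd : (3 <= d)%N) :
  exists (k : R) (n0 : nat)
    (F : forall n : nat,
       regular_graph n d -> (num_queries R n).-tuple 'I_n -> bool)
    (Q : forall n : nat, (num_queries R n).-tuple nat),
    0 < k /\
    (forall n : nat, uniq (Q n)) /\
    forall n : nat, (n0 <= n)%N -> (odd d -> ~~ odd n) ->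
    forall A : algorithm R n d,
      probes_per_query_lt A (Q n) (n%:R `^ 4^-1 / k) ->
      99%:R / 100%:R <=
        expect_graph (fun G : regular_graph n d =>
          `| expect_bool (F n G) (walk_law R G (Q n))
             - expect_bool (F n G) (response_law G A (Q n)) |).
Proof.
(* The threshold makes the fourth root of n at least 4000 + 100d. The start vertex is quantified
   because the functions must also be defined for n = 0. *)
exists 100%:R, ((4000 + 100 * d) ^ 4)%N,
  (fun n G x => [exists v : 'I_n, (val v == 0%N) &&
     accepts (n%:R `^ 4^-1 / 100%:R : R) v G (tval x)]),
  (fun n => end_first (num_queries R n)).
split; first by rewrite ltr0n.
split=> [n|n nbig odn A hA]; first exact: uniq_end_first.
move: hA; set m := num_queries R n => hA.
have := powR_fourth_root R n; set r : R := n%:R `^ 4^-1 => r4.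
set b : R := r / 100%:R; set l := Num.truncn b.
have r0 : 0 <= r by rewrite powR_ge0.
have dR : 3%:R <= d%:R :> R by rewrite ler_nat.
have rA : 4000%:R + 100%:R * d%:R <= r.
  rewrite -natrM -natrD -(@ler_pXn2r _ 4) ?nnegrE ?ler0n // r4 -natrX ler_nat.
  exact: nbig.
clear nbig.
have /andP[mr rm] : m%:R <= r < m.+1%:R by exact: truncn_itv.
have b0 : 0 <= b by rewrite /b divr_ge0.
have lb : l%:R <= b by rewrite truncn_le.
have rn : r <= n%:R.
  by rewrite -r4 -[leLHS]expr1 ler_weXn2l //; lra.
have n_gt0 : (0 < n)%N by rewrite -(ltr0n R); lra.
have dn : (d < n)%N by rewrite -(ltr_nat R); lra.
pose v0 := Ordinal n_gt0.
have FE G (D : m.-tuple 'I_n -> R) : expect_bool (fun x => [exists v : 'I_n, (val v == 0%N) &&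
     accepts b v G (tval x)]) D = expect_bool (fun x => accepts b v0 G (tval x)) D.
  apply: eq_bigr => x _; congr (_ * (nat_of_bool _)%:R).
  apply/existsP/idP => [[v /andP[/eqP v0E]]|h]; last by exists v0.
  by have -> : v = v0 by exact: val_inj.
have qr : (m * l)%N%:R <= r ^+ 2 / 100%:R :> R.
  rewrite natrM; have -> : r ^+ 2 / 100%:R = r * b by rewrite /b; field.
  exact: ler_pM.
have [err big] := response_error_small dR rA (ler0n R (m * l)) qr.
rewrite r4 -[2%:R * (m * l)%:R]natrM -natrD in err; rewrite r4 in big.
have {}big : (4 * (m * l) + 4 * (d.+1 * d) <= n * d)%N.
  by rewrite -(ler_nat R) natrD !natrM -[d.+1%:R]natr1 -natrM.
have lm : (9 * l + 3400 <= m)%N.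
  by rewrite -ltnS -(ltr_nat R) natrD natrM -[m.+1%:R]natr1; rewrite /b in lb; lra.
have m_gt0 : (0 < m)%N by rewrite (leq_trans _ lm) // addn_gt0 orbT.
have N0 : 0 < #|{: regular_graph n d}|%:R :> R by rewrite ltr0n regular_graph_exists.
rewrite /expect_graph ler_pdivlMr //.
have walk : (1 - 200%:R^-1) * #|{: regular_graph n d}|%:R <= \sum_(G : regular_graph n d)
    expect_bool (fun x => accepts b v0 G (tval x)) (walk_law R G (end_first m)).
  rewrite mulr_natr -sumr_const; apply: ler_sum => G _.
  apply: le_trans (expect_accepted_walk G b hd (erefl : val v0 = 0%N) m_gt0).
  by rewrite lerB // walk_error_small.
have resp := expect_accepted_responses v0 (ltnW (ltnW hd)) b0 m_gt0 big hA.
have {}resp := le_trans resp (ler_wpM2r (ltW N0) err).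
(* The absolute value is bounded below by the signed difference, and 1 - 1/200 - 1/200 = 99/100. *)
apply: le_trans (_ : \sum_(G : regular_graph n d)
    (expect_bool (fun x => accepts b v0 G (tval x)) (walk_law R G (end_first m))
     - expect_bool (fun x => accepts b v0 G (tval x)) (response_law G A (end_first m))) <= _).
  rewrite sumrB; apply: le_trans (lerB walk resp).
  by rewrite -mulrBl ler_pM2r //; lra.
by apply: ler_sum => G _; rewrite !FE ler_norm.
Qed.
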